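(* For every integer $K\ge 3$ there exist a positive integer $M(K)$ and points $x_1,\dots,x_{M(K)}\in(0,1)$ such that $\{x_i\}_{i=1}^{M(K)}$ is a set of uniqueness for $\mathscr{G}_K$; that is, whenever $F,G\in\mathscr{G}_K$ satisfy $F(x_i)=G(x_i)$ for all $i$, then $F=G$. Moreover $M(K)=O(K^3)$ as $K\to\infty$.
   Context: A Cantor set is specified by an integer scale factor $N\ge 3$ and a digit set $D\subset\{0,1,\dots,N-1\}$ with $2\le |D|\le N-1$; equivalently by its binary digit vector $\vec B=(b_0,\dots,b_{N-1})\in\{0,1\}^N$ with $b_i=1$ iff $i\in D$, and $\|\vec B\|:=\sum_i b_i=|D|$. With $\phi_d(x)=(x+d)/N$ for $d\in D$, the Cantor set $C_{\vec B}\subset[0,1]$ is the unique nonempty compact set with $C_{\vec B}=\bigcup_{d\in D}\phi_d(C_{\vec B})$, and $\mu_{\vec B}$ is the unique Borel probability measure with $\mu_{\vec B}=\frac{1}{\|\vec B\|}\sum_{d\in D}\mu_{\vec B}\circ\phi_d^{-1}$ (it is supported on $C_{\vec B}$). The CDF of the Cantor set is $F_{\vec B}(x)=\mu_{\vec B}([0,x])$ for $x\in[0,1]$. For $K\ge 3$, $\mathscr{G}_K$ denotes the set of all functions $F_{\vec B}$ where $\vec B$ ranges over all such binary digit vectors with scale factor (length) $N\le K$ (different vectors may give the same function). *)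

(* Defs.v *)
From HB Require Import structures.
From mathcomp Require Import all_boot all_order all_algebra.
From mathcomp Require Import all_classical all_reals all_analysis.
Set Implicit Arguments. Unset Strict Implicit. Unset Printing Implicit Defensive.
Import Order.TTheory GRing.Theory Num.Theory.
Local Open Scope classical_set_scope.
Local Open Scope ring_scope.

Definition cantor_map {R : realType} (N d : nat) (x : R) : R :=
  (x + d%:R) / N%:R.

Definition cantor_data (N : nat) (D : {set 'I_N}) : Prop :=
  (3 <= N)%N /\ (2 <= #|D|)%N /\ (#|D| <= N.-1)%N.

Definition cantor_invariant {R : realType} (N : nat) (D : {set 'I_N})
    (mu : probability R R) : Prop :=
  forall A : set R, measurable A ->
    (mu A = ((#|D|%:R)^-1)%:E *
           \sum_(d in D) mu (cantor_map N (nat_of_ord d) @^-1` A))%E.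

(* F_B(x) = mu_B([0,x]) for x in [0,1], where mu_B is the invariant
   probability measure (unique, so any invariant one may be used). *)
Definition is_cantor_cdf {R : realType} (N : nat) (D : {set 'I_N})
    (F : R -> R) : Prop :=
  cantor_data D /\
  exists mu : probability R R, cantor_invariant D mu /\
    forall x : R, 0 <= x <= 1 -> (F x)%:E = mu `[0, x]%classic.

Definition in_GK {R : realType} (K : nat) (F : R -> R) : Prop :=
  exists (N : nat) (D : {set 'I_N}), (N <= K)%N /\ is_cantor_cdf D F.

(* Main.v *)
Require Import Defs.
From HB Require Import structures.
From mathcomp Require Import all_boot all_order all_algebra.
From mathcomp Require Import all_classical all_reals all_analysis.
From mathcomp Require Import zify ring lra.
Import Order.TTheory GRing.Theory Num.Theory.
Local Open Scope ring_scope.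

(* Let [F] and [G] have scales [N <= M].
   If [N] and [M] are multiplicatively dependent, then [N] divides [M], so the
   grid of mesh [1/M^2] contains the one of mesh [1/(NM)]. Agreement on the
   latter makes the two self-similarity operators commute, hence [G] is also a
   fixed point of the operator of [F], and [F = G]. All these grids together
   have [O(K^3)] points.
   If [N] and [M] are independent, then [F = G] is impossible and has to be
   refuted. The points [d/(N-1)] and [d/(M-1)] force the left ends of the two
   Cantor sets to be the same point [z]. Then [F] scales by [1/|D|] under the
   contraction of ratio [1/N] at [z], and [G] by [1/|E|] under that of ratio
   [1/M]. Agreement at [z + M^-b (1 - z)] therefore gives
   [F(z + N^a M^-b (1 - z)) = |D|^a / |E|^b]. Since the numbers [N^a M^-b] are
   dense, three of these points lie in one interval where [F] is constant, with
   exponents that make equality of the three values absurd. Such an interval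
   can be chosen among [O(K)] candidates for given [N], so [O(K^3)] points
   suffice again. *)

(** * Separating products of powers of two independent integers *)

(** For positive reals this is irrationality of [a / b]; for logarithms of integers above 1 it is
    multiplicative independence. *)
Definition incommensurable {R : realType} (a b : R) : Prop :=
  forall r s : nat, (0 < r)%N -> (0 < s)%N -> r%:R * a <> s%:R * b.

Lemma incommensurable_sym (R : realType) (a b : R) :
  incommensurable a b -> incommensurable b a.
Proof. by move=> ab r s r0 s0 /esym; exact: ab. Qed.

Lemma incommensurable_neq (R : realType) (a b : R) (r s : nat) :
  0 < a -> incommensurable a b -> (0 < r)%N -> r%:R * a <> s%:R * b.
Proof.
move=> a0 ab r0; case: s => [|s]; last exact: ab.
by rewrite mul0r => /eqP; rewrite mulf_eq0 pnatr_eq0 !gt_eqF.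
Qed.

(** Pigeonhole: among [k + 1] fractional parts of [n * a / b] two share one of [k] boxes, so they
    differ by less than [1 / k], where [b / k < e]. *)
Lemma small_combination (R : realType) (a b e : R) :
  0 < a -> 0 < b -> 0 < e -> incommensurable a b ->
  exists r s : nat, 0 < `|r%:R * a - s%:R * b| < e.
Proof.
move=> a0 b0 e0 ab.
have [k [k0 bk]] : exists k : nat, (0 : R) < k%:R /\ b < k%:R * e.
  exists (Num.truncn (b / e)).+1.
  by rewrite ltr0n -ltr_pdivrMr// truncnS_gt.
pose q (n : nat) := Num.truncn (n%:R * a / b).
pose g (n : nat) : R := n%:R * a / b - (q n)%:R.
have qP n : (q n)%:R <= n%:R * a / b < (q n).+1%:R.
  by apply: truncn_itv; rewrite divr_ge0 ?mulr_ge0// ltW.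
have gP n : 0 <= g n < 1.
  by have := qP n; rewrite /g -natr1 => /andP[? ?]; apply/andP; split; lra.
have fP n : (Num.truncn (k%:R * g n)%R < k)%N.
  case/andP: (gP n) => g0 g1.
  have /andP[h _] := truncn_itv (mulr_ge0 (ltW k0) g0).
  rewrite -(ltr_nat R); apply: le_lt_trans h _.
  by rewrite -[ltRHS]mulr1 ltr_pM2l.
pose f (n : 'I_k.+1) : 'I_k := Ordinal (fP n).
have /injectivePn[i [j ij fij]] : ~~ injectiveb f.
  by apply/negP => /injectiveP/leq_card; rewrite !card_ord ltnn.
wlog lij : i j ij fij / (i < j)%N.
  move=> W; have : i != j by [].
  rewrite neq_ltn => /orP[|lt]; first exact: W ij fij.
  by apply: (W j i) => //; rewrite eq_sym.
have qij : (q i <= q j)%N.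
  by apply: le_truncn; rewrite ler_pM2r ?invr_gt0// ler_pM2r// ler_nat ltnW.
exists (j - i)%N, (q j - q i)%N.
rewrite !natrB// 1?ltnW//.
have -> : (j%:R - i%:R) * a - ((q j)%:R - (q i)%:R) * b = (g j - g i) * b :> R.
  by rewrite /g; field; rewrite gt_eqF.
have neq : (g j - g i) * b != 0.
  apply/eqP => h.
  apply: (@incommensurable_neq _ a b (j - i) (q j - q i)) => //.
    by rewrite subn_gt0.
  rewrite !natrB// 1?ltnW//; apply/eqP; rewrite -subr_eq0; apply/eqP.
  rewrite -[RHS]h /g; field; by rewrite gt_eqF.
rewrite normr_gt0 neq /=.
have fR : Num.truncn (k%:R * g i) = Num.truncn (k%:R * g j).
  by move/(congr1 val): fij.
have /andP[i1 i2] := truncn_itv (mulr_ge0 (ltW k0) (proj1 (andP (gP i)))).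
have /andP[j1 j2] := truncn_itv (mulr_ge0 (ltW k0) (proj1 (andP (gP j)))).
rewrite fR -?natr1 in i1 i2; rewrite -natr1 in j2.
rewrite normrM (gtr0_norm b0).
have h : `|g j - g i| * k%:R < 1.
  rewrite -(gtr0_norm k0) -normrM ltr_norml; apply/andP; split; nra.
have := ler_pM2l k0; nra.
Qed.

(** If the small combination is negative, say [- w], the remainder of [a] modulo [w] is again a
    combination; it is below [w], and nonzero by incommensurability. *)
Lemma small_positive_combination (R : realType) (a b e : R) :
  0 < a -> 0 < b -> 0 < e -> incommensurable a b ->
  exists r s : nat, 0 < r%:R * a - s%:R * b < e.
Proof.
move=> a0 b0 e0 ab.
have [r [s /andP[w0 we]]] := small_combination _ a b e a0 b0 e0 ab.
have [pos|neg] := ltP 0 (r%:R * a - s%:R * b).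
  by exists r, s; rewrite pos -(gtr0_norm pos).
rewrite ler0_norm// in w0 we.
set w := - (r%:R * a - s%:R * b) in w0 we.
pose k := Num.truncn (a / w).
have /andP[k1 k2] : k%:R <= a / w < k.+1%:R.
  by apply: truncn_itv; rewrite divr_ge0// ltW.
rewrite ler_pdivlMr// in k1; rewrite ltr_pdivrMr// -natr1 in k2.
exists (1 + k * r)%N, (k * s)%N.
have eqw : (1 + k * r)%:R * a - (k * s)%:R * b = a - k%:R * w.
  by rewrite /w natrD !natrM; ring.
have : (1 + k * r)%:R * a - (k * s)%:R * b != 0.
  by rewrite subr_eq0; apply/eqP; exact: incommensurable_neq.
rewrite eqw => ne0; apply/andP; split; last lra.
by rewrite lt_neqAle eq_sym ne0 /= subr_ge0.
Qed.

(** Walking down from 0 in steps shorter than [h - l] cannot jump over the interval; [h <= 0] puts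
    it below the start. *)
Lemma dense_combination (R : realType) (a b l h : R) :
  0 < a -> 0 < b -> l < h -> h <= 0 -> incommensurable a b ->
  exists r s : nat, l < r%:R * a - s%:R * b < h.
Proof.
move=> a0 b0 lh h0 ab.
have [r [s /andP[x0 xlt]]] := small_positive_combination _ b a (h - l) b0 a0
  (ltac:(by rewrite subr_gt0)) (incommensurable_sym _ _ _ ab).
set x := r%:R * b - s%:R * a in x0 xlt.
pose k := Num.truncn (- h / x).
have /andP[k1 k2] : k%:R <= - h / x < k.+1%:R.
  by apply: truncn_itv; rewrite divr_ge0 ?oppr_ge0// ltW.
rewrite ler_pdivlMr// in k1; rewrite ltr_pdivrMr// in k2.
exists (k.+1 * s)%N, (k.+1 * r)%N.
have -> : (k.+1 * s)%:R * a - (k.+1 * r)%:R * b = - (k.+1%:R * x).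
  by rewrite /x !natrM; ring.
move: k2; rewrite -natr1 => k2; apply/andP; split; lra.
Qed.

(* The three points are [t], [t * w] and [t * w'] with [w > 1 > w']: equality
   of the powers would make [(r, s)] and [(r', s')] positively proportional. *)
Lemma separating_exponents (R : realType) (N M : nat) (u v : R) :
  (1 < N)%N -> (1 < M)%N -> 0 < u -> u < v -> v <= 1 ->
  incommensurable (ln (N%:R : R)) (ln M%:R) ->
  exists a b : 'I_3 -> nat,
    (forall i, u < N%:R ^+ a i / M%:R ^+ b i < v) /\
    forall m n : nat, (1 < m)%N -> (1 < n)%N ->
      (forall i j,
         m%:R ^+ a i / n%:R ^+ b i = m%:R ^+ a j / n%:R ^+ b j :> R) ->
      False.
Proof.
move=> N1 M1 u0 uv v1; set A := ln _; set B := ln _ => AB.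
have N0 : (0 : R) < N%:R by rewrite ltr0n ltnW.
have M0 : (0 : R) < M%:R by rewrite ltr0n ltnW.
have A0 : 0 < A by rewrite ln_gt0// ltr1n.
have B0 : 0 < B by rewrite ln_gt0// ltr1n.
have v0 : 0 < v by exact: lt_trans uv.
have luv : ln u < ln v by rewrite ltr_ln.
have lv0 : ln v <= 0 by exact: ln_le0.
(* A base point in the middle third leaves room for one move up and one move down, each shorter than
   [d]. *)
pose d := (ln v - ln u) / 3.
have d0 : 0 < d by rewrite divr_gt0// subr_gt0.
have dE : ln v = ln u + 3 * d by rewrite /d; field.
have [a [b /andP[ab1 ab2]]] := dense_combination _ A B (ln u + d) (ln v - d)
  A0 B0 (ltac:(lra)) (ltac:(lra)) AB.
have [r [s /andP[rs1 rs2]]] := small_positive_combination _ A B d A0 B0 d0 AB.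
have [s' [r' /andP[rs1' rs2']]] := small_positive_combination _ B A d B0 A0 d0
  (incommensurable_sym _ _ _ AB).
pose P (i : 'I_3) : nat * nat :=
  nth (a, b) [:: (a, b); (a + r, b + s); (a + r', b + s')]%N i.
exists (fun i => (P i).1), (fun i => (P i).2); split.
  move=> i.
  have p0 x y : 0 < N%:R ^+ x / M%:R ^+ y :> R by rewrite divr_gt0// exprn_gt0.
  have -> : (u < N%:R ^+ (P i).1 / M%:R ^+ (P i).2 < v) =
      (ln u < ln (N%:R ^+ (P i).1 / M%:R ^+ (P i).2 : R) < ln v).
    by rewrite !ltr_ln ?posrE ?p0.
  rewrite ln_div ?posrE ?exprn_gt0// !lnXn// -/A -/B -(mulr_natl A) -(mulr_natl B).
  rewrite /P; case: i => -[|[|[|//]]] /= _; rewrite ?natrD; apply/andP; split;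
    by clear p0; clearbody A B d; lra.
move=> m n m1 n1 E.
have m0 : (m%:R : R) != 0 by rewrite pnatr_eq0 -lt0n ltnW.
have n0 : (n%:R : R) != 0 by rewrite pnatr_eq0 -lt0n ltnW.
have cancel x y : m%:R ^+ a / n%:R ^+ b = m%:R ^+ (a + x) / n%:R ^+ (b + y) :> R ->
    (m ^ x = n ^ y)%N.
  move=> h; apply/eqP; rewrite -(eqr_nat R) !natrX; apply/eqP.
  have am : (m%:R : R) ^+ a != 0 by rewrite expf_neq0.
  have bn : (n%:R : R) ^+ b != 0 by rewrite expf_neq0.
  have yn : (n%:R : R) ^+ y != 0 by rewrite expf_neq0.
  apply: (mulfI am); apply: (mulIf (invr_neq0 bn)); apply: (mulIf (invr_neq0 yn)).
  transitivity (m%:R ^+ (a + x) / n%:R ^+ (b + y) :> R).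
    by rewrite !exprD; field; rewrite bn yn.
  by rewrite -h; field; rewrite bn yn.
have rsE := cancel r s (E ord0 (@Ordinal 3 1 isT)).
have rsE' := cancel r' s' (E ord0 (@Ordinal 3 2 isT)).
have : (r * s' = r' * s)%N.
  have : (m ^ (r * s') = m ^ (r' * s))%N.
    by rewrite !expnM rsE rsE' -!expnM mulnC.
  by move/eqP; rewrite eqn_exp2l// => /eqP.
move/(congr1 (fun x : nat => x%:R : R)); rewrite !natrM => p.
have s'0 : (0 : R) < s'%:R.
  rewrite ltr0n lt0n; apply/eqP => z; rewrite z mul0r in rs1'.
  have : 0 <= r'%:R * A by rewrite mulr_ge0// ltW.
  lra.
have s0 : (0 : R) <= s%:R by [].
have : s'%:R * (s%:R * B) < s'%:R * (r%:R * A) by rewrite ltr_pM2l//; lra.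
have : s%:R * (r'%:R * A) <= s%:R * (s'%:R * B) by rewrite ler_wpM2l//; lra.
nra.
Qed.

(** * The functional equation of the distribution function *)

Lemma expn_small (R : realType) (N : nat) (C e : R) :
  (1 < N)%N -> 0 < e -> exists n : nat, C / N%:R ^+ n < e.
Proof.
move=> N1 e0; exists (Num.truncn (C / e)).+1.
have N0 : (0 : R) < N%:R by rewrite ltr0n ltnW.
rewrite ltr_pdivrMr ?exprn_gt0// mulrC -ltr_pdivrMr//.
apply: lt_trans (truncnS_gt _) _.
by rewrite -natrX ltr_nat; exact: ltn_expl.
Qed.

Definition digits_below (N : nat) (D : {set 'I_N}) (d : nat) : nat :=
  #|[set e in D | (e < d)%N]|.

(** Everything that the argument uses of the invariant measure. *)
Record cantor_function {R : realType} (N : nat) (D : {set 'I_N}) (F : R -> R)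
    : Prop := {
  cantor_function0 : F 0 = 0 ;
  cantor_function1 : F 1 = 1 ;
  cantor_function_le : forall x y, 0 <= x -> x <= y -> y <= 1 -> F x <= F y ;
  cantor_functionE : forall (d : 'I_N) x, 0 <= x <= 1 ->
    F ((x + d%:R) / N%:R) =
    ((digits_below N D d)%:R + (d \in D)%:R * F x) / #|D|%:R }.

Section invariant_cdf.
Context {R : realType} {N : nat} {D : {set 'I_N}}.
Hypothesis dataD : cantor_data D.
Variable mu : probability R R.
Hypothesis invmu : cantor_invariant D mu.

(** Seen as the law of the identity random variable, [mu] inherits the limits of a distribution
    function at both infinities. *)
Let idR : R -> R := idfun.

HB.instance Definition _ :=
  @isMeasurableFun.Build _ _ _ _ idR (@measurable_id _ _ setT).

Let X : {RV mu >-> R} := idR.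
(** Defined on the whole line: that [mu] lives on [[0, 1]] is not assumed and has to be derived from
    invariance. *)
Let Phi (x : R) : R := fine (mu `]-oo, x]%classic).

Let PhiE x : mu `]-oo, x]%classic = (Phi x)%:E.
Proof. by rewrite fineK// fin_num_measure. Qed.

Let Phi_le x y : x <= y -> Phi x <= Phi y.
Proof.
move=> xy; rewrite -lee_fin -!PhiE le_measure ?inE//.
exact: subitvPr.
Qed.

Let Phi_ge0 x : 0 <= Phi x.
Proof. by rewrite -lee_fin -PhiE. Qed.

Let Phi_le1 x : Phi x <= 1.
Proof. by rewrite -lee_fin -PhiE probability_le1. Qed.

Let N0 : 0 < N%:R :> R.
Proof. by case: dataD => N3 _; rewrite ltr0n; lia. Qed.

Let D0 : 0 < #|D|%:R :> R.
Proof. by case: dataD => _ [D2 _]; rewrite ltr0n; lia. Qed.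

Let Phi_avg x : Phi x = #|D|%:R^-1 * \sum_(d in D) Phi (N%:R * x - d%:R).
Proof.
apply: EFin_inj; rewrite -PhiE invmu// EFinM -sumEFin; congr (_ * _)%E.
apply: eq_bigr => d _; rewrite -PhiE; congr (mu _).
apply/seteqP; split=> y /=; rewrite /cantor_map !in_itv/= ler_pdivrMr//;
  by rewrite lerBrDr mulrC.
Qed.

Let le_avg (f : 'I_N -> R) (a : R) :
  (forall d, d \in D -> f d <= a) -> #|D|%:R^-1 * \sum_(d in D) f d <= a.
Proof.
move=> fa; rewrite ler_pdivrMl// mulr_natl -sumr_const.
exact: ler_sum.
Qed.

Let ge_avg (f : 'I_N -> R) (a : R) :
  (forall d, d \in D -> a <= f d) -> a <= #|D|%:R^-1 * \sum_(d in D) f d.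
Proof.
move=> fa; rewrite ler_pdivlMl// mulr_natl -sumr_const.
exact: ler_sum.
Qed.

Let exp_gt (t : R) (A : R) : 0 < t -> exists n, A < N%:R ^+ n * t.
Proof.
move=> t0; have [|n] := expn_small R N A t _ t0; first by case: dataD; lia.
by rewrite ltr_pdivrMr ?exprn_gt0// mulrC; exists n.
Qed.

(** Averaging only involves points at or below [N * x], so [Phi x <= Phi (N ^ n * x)], which tends
    to 0. *)
Let Phi_lt0 x : x < 0 -> Phi x = 0.
Proof.
move=> x0; apply/eqP; rewrite eq_le Phi_ge0 andbT.
have h n : Phi x <= Phi (- (N%:R ^+ n * - x)).
  elim: n => [|n /le_trans]; first by rewrite expr0 mul1r opprK.
  apply; rewrite exprS -mulrA; set y := N%:R ^+ n * - x.
  rewrite Phi_avg; apply: le_avg => d _; apply: Phi_le.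
  rewrite mulrN lerBlDr lerDl ler0n //.
apply/ler_addgt0Pl => e e0; rewrite addr0.
have /fine_cvgP[_ /cvgrPdist_lt/(_ _ e0)] := cvg_cdfNy0 X.
move=> [A [_ hA]].
have [n hn] := exp_gt (- x) (- A) (ltac:(by rewrite oppr_gt0)).
apply: le_trans (h n) _.
have /= := hA (- (N%:R ^+ n * - x)) (ltac:(by rewrite ltrNl)).
rewrite sub0r normrN /cdf /distribution /pushforward /= -/(Phi _).
by rewrite ger0_norm// => /ltW.
Qed.

(** Each averaging multiplies the distance to 1 by at least [N], and [Phi] tends to 1 at
    infinity. *)
Let Phi_gt1 x : 1 < x -> Phi x = 1.
Proof.
move=> x1; apply/eqP; rewrite eq_le Phi_le1 /=.
have h n : Phi (1 + N%:R ^+ n * (x - 1)) <= Phi x.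
  elim: n => [|n]; first by rewrite expr0 mul1r addrC subrK.
  apply: le_trans; rewrite exprS -mulrA; set y := N%:R ^+ n * (x - 1).
  rewrite (Phi_avg (1 + y)); apply: ge_avg => d _; apply: Phi_le.
  have : (d.+1%:R : R) <= N%:R by rewrite ler_nat.
  rewrite -natr1; lra.
apply/ler_addgt0Pl => e e0.
have /fine_cvgP[_ /cvgrPdist_lt/(_ _ e0)] := cvg_cdfy1 X.
move=> [A [_ hA]].
have [n hn] := exp_gt (x - 1) A (ltac:(by rewrite subr_gt0)).
have /= := hA (1 + (N%:R ^+ n * (x - 1))) (ltac:(lra)).
rewrite /cdf /distribution /pushforward /= -/(Phi _).
rewrite ltr_norml => /andP[_ ?]; have := h n; lra.
Qed.

(** In the average at 0 only the digit 0 can contribute, so [#|D| * Phi 0 <= Phi 0], with at least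
    two digits. *)
Let Phi0 : Phi 0 = 0.
Proof.
apply/eqP; rewrite eq_le Phi_ge0 andbT.
have : #|D|%:R * Phi 0 <= Phi 0.
  rewrite {1}Phi_avg mulrA mulfV ?mul1r ?gt_eqF// mulr0.
  have [/existsP[d0 /andP[d0D /eqP z]]|] :=
      boolP [exists d : 'I_N, (d \in D) && (d == 0%N :> nat)].
    rewrite (bigD1 d0)//= z subr0 big1 ?addr0// => d /andP[_ dd0].
    rewrite sub0r Phi_lt0// oppr_lt0 ltr0n lt0n; apply: contraNneq dd0 => dz.
    by apply/eqP/val_inj; rewrite /= dz z.
  rewrite negb_exists => /forallP nz.
  rewrite big1// => d dD; rewrite sub0r Phi_lt0// oppr_lt0 ltr0n lt0n.
  by have := nz d; rewrite dD.
case: dataD => _ [D2 _].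
have : (2 : R) <= #|D|%:R by rewrite ler_nat.
have := Phi_ge0 0; nra.
Qed.

(** The mirror argument for [1 - Phi 1], where only the digit [N - 1] can contribute. *)
Let Phi1 : Phi 1 = 1.
Proof.
apply/eqP; rewrite eq_le Phi_le1 /=.
have : #|D|%:R * (1 - Phi 1) <= 1 - Phi 1.
  rewrite mulrBr mulr1 {1}Phi_avg mulrA mulfV ?mul1r ?gt_eqF// mulr1.
  rewrite -sumr_const -sumrB.
  have [/existsP[d0 /andP[d0D /eqP z]]|] :=
      boolP [exists d : 'I_N, (d \in D) && (d.+1 == N :> nat)].
    have zR : (N%:R : R) = d0%:R + 1 by rewrite natr1 z.
    rewrite (bigD1 d0)//= big1 ?addr0; last first.
      move=> d /andP[_ dd0]; rewrite Phi_gt1 ?subrr//.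
      have : (d.+2%:R : R) <= N%:R.
        rewrite ler_nat ltn_neqAle ltn_ord andbT.
        apply: contraNneq dd0 => dz; apply/eqP/val_inj => /=; lia.
      rewrite -!natr1; lra.
    by rewrite zR (_ : d0%:R + 1 - d0%:R = 1) //; lra.
  rewrite negb_exists => /forallP nz.
  rewrite big1 ?subr_ge0// => d dD; rewrite Phi_gt1 ?subrr//.
  have : (d.+2%:R : R) <= N%:R.
    by have := nz d; rewrite dD /= ler_nat [(_ < N)%N]ltn_neqAle ltn_ord andbT.
  rewrite -!natr1; lra.
case: dataD => _ [D2 _].
have : (2 : R) <= #|D|%:R by rewrite ler_nat.
have := Phi_le1 1; nra.
Qed.

Let Phi_le0 x : x <= 0 -> Phi x = 0.
Proof. by rewrite le_eqVlt => /orP[/eqP->|/Phi_lt0]. Qed.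

Let Phi_ge1 x : 1 <= x -> Phi x = 1.
Proof. by rewrite le_eqVlt => /orP[/eqP<-|/Phi_gt1]. Qed.

Let mu_itv x : 0 <= x -> mu `[0, x]%classic = (Phi x)%:E.
Proof.
move=> x0; rewrite -PhiE; apply/eqP; rewrite eq_le; apply/andP; split.
  rewrite le_measure ?inE// => y /=; rewrite !in_itv/= => /andP[_ //].
have sub : (`]-oo, x]%classic `<=` `]-oo, 0%R]%classic `|` `[0%R, x]%classic)%classic.
  move=> y /=; rewrite !in_itv /= => yx.
  by have [y0|y0] := leP y 0; [left|right; rewrite ltW].
apply: (@le_trans _ _ (mu (`]-oo, 0%R]%classic `|` `[0%R, x]%classic)%classic)).
  by rewrite le_measure ?inE//; exact: measurableU.
apply: le_trans (measureU2 _ _ _) _ => //.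
rewrite [X in (X + _)%E](_ : _ = 0%E) ?add0e//.
by have := PhiE 0; rewrite Phi0.
Qed.

Lemma invariant_cantor_function (F : R -> R) :
  (forall x, 0 <= x <= 1 -> (F x)%:E = mu `[0, x]%classic) ->
  cantor_function N D F.
Proof.
move=> FE.
have FPhi x : 0 <= x <= 1 -> F x = Phi x.
  by move=> x01; apply: EFin_inj; rewrite FE// mu_itv//; case/andP: x01.
split.
- by rewrite FPhi// ?lexx ?ler01.
- by rewrite FPhi// ?lexx ?ler01.
- move=> x y x0 xy y1; rewrite !FPhi ?Phi_le ?x0 ?y1//.
    by rewrite (le_trans x0).
  by rewrite (le_trans xy).
move=> d x /andP[x0 x1].
have dN : (d.+1%:R : R) <= N%:R by rewrite ler_nat.
rewrite FPhi; last first.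
  rewrite divr_ge0 ?addr_ge0//= ?ler0n// ler_pdivrMr// mul1r.
  rewrite -natr1 in dN; lra.
rewrite Phi_avg (mulrC N%:R) divfK ?gt_eqF// mulrC FPhi ?x0//; congr (_ / _).
(* Digits below [d] see an argument at least 1, digits above [d] one at most 0; only [d] itself sees
   [x]. *)
have Phi_d (e : 'I_N) : Phi (x + d%:R - e%:R) =
    (e < d)%:R + (e == d)%:R * Phi x.
  have [ed|de|/val_inj->] := ltngtP e d.
  - have : (e.+1%:R : R) <= d%:R by rewrite ler_nat.
    rewrite -natr1 => h; rewrite Phi_ge1; last lra.
    by rewrite (_ : e == d = false) ?mul0r ?addr0//; apply/eqP => E; rewrite E ltnn in ed.
  - have : (d.+1%:R : R) <= e%:R by rewrite ler_nat.
    rewrite -natr1 => h; rewrite Phi_le0; last lra.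
    by rewrite (_ : e == d = false) ?mul0r ?addr0//; apply/eqP => E; rewrite E ltnn in de.
  - by rewrite eqxx mul1r add0r addrK.
under eq_bigr do rewrite Phi_d.
rewrite big_split /=; congr (_ + _).
  rewrite /digits_below -sum1_card natr_sum big_mkcond [RHS]big_mkcond /=.
  by apply: eq_bigr => e _; rewrite inE; case: (e \in D); case: (_ < _)%N.
rewrite big_mkcond (bigD1 d)//= eqxx mul1r big1 ?addr0.
  by case: (d \in D); rewrite ?mul1r ?mul0r.
by move=> e /negPf->; rewrite mul0r; case: ifP.
Qed.

End invariant_cdf.

(** * Self-similar functions *)

(** A contraction principle without suprema: iteration bounds [E] by [C / 2 ^ n] for every [n]. The
    index will be a point, or a digit together with a point. *)
Lemma halving_eq0 (R : realType) (T : Type) (P : T -> Prop) (E : T -> R)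
    (C : R) :
  (forall t, P t -> `|E t| <= C) ->
  (forall t, P t -> exists2 t', P t' & `|E t| <= `|E t'| / 2) ->
  forall t, P t -> E t = 0.
Proof.
move=> EC half t Pt.
have h n : forall t, P t -> `|E t| <= C / 2%:R ^+ n.
  elim: n => [|n IH] u Pu; first by rewrite expr0 divr1; exact: EC.
  have [u' /IH h1 h2] := half u Pu.
  by rewrite exprSr invfM mulrA; lra.
apply/eqP; rewrite -normr_le0; apply/ler_addgt0Pl => e e0; rewrite addr0.
have [n /ltW hn] := expn_small R 2 C e isT e0.
exact: le_trans (h n t Pt) hn.
Qed.

Lemma digit_expansion (R : realType) (N : nat) (x : R) :
  (0 < N)%N -> 0 <= x <= 1 ->
  exists d (y : R), [/\ (d < N)%N, 0 <= y <= 1 & x = (y + d%:R) / N%:R].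
Proof.
move=> N0 /andP[x0 x1]; have NR : (0 : R) < N%:R by rewrite ltr0n.
(* At [x = 1] truncation would return the invalid digit [N]. *)
have [->|xn1] := eqVneq x 1.
  exists N.-1, 1; split; rewrite ?ler01 ?lexx ?prednK//.
  by rewrite -{2}(prednK N0) -natr1 addrC divff// natr1 prednK// gt_eqF.
have Nx : 0 <= N%:R * x by rewrite mulr_ge0// ltW.
have /andP[d1 d2] := truncn_itv Nx.
exists (Num.truncn (N%:R * x)), (N%:R * x - (Num.truncn (N%:R * x))%:R); split.
- rewrite -(ltr_nat R); apply: le_lt_trans d1 _.
  by rewrite -[ltRHS]mulr1 ltr_pM2l// lt_neqAle xn1.
- by rewrite -natr1 in d2; apply/andP; split; lra.
- by rewrite subrK mulrC mulKf// gt_eqF.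
Qed.

(* Both endpoints of the cells of mesh [1/N] enter through their [F]-values, so
   the relation does not mention the digit set; it is meant for functions with
   [F 0 = 0] and [F 1 = 1]. *)
Definition self_similar {R : realType} (N : nat) (F : R -> R) : Prop :=
  forall d x, (d < N)%N -> 0 <= x <= 1 ->
    F ((x + d%:R) / N%:R) =
    F (d%:R / N%:R) + (F (d.+1%:R / N%:R) - F (d%:R / N%:R)) * F x.

(** Bounds the contraction factors in [self_similar]; [1 / 2] suffices since a Cantor set has at
    least two digits. *)
Definition halving {R : realType} (N : nat) (F : R -> R) : Prop :=
  forall d, (d < N)%N -> 0 <= F (d.+1%:R / N%:R) - F (d%:R / N%:R) <= 2^-1.

Definition unit_valued {R : realType} (F : R -> R) : Prop :=
  [/\ F 0 = 0, F 1 = 1 & forall x, 0 <= x <= 1 -> 0 <= F x <= 1].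

Lemma itv01_div (R : realType) (N d : nat) (x : R) :
  (d < N)%N -> 0 <= x <= 1 -> 0 <= (x + d%:R) / N%:R <= 1.
Proof.
move=> dN /andP[x0 x1]; have N0 : (0 : R) < N%:R by rewrite ltr0n; lia.
have : (d.+1%:R : R) <= N%:R by rewrite ler_nat.
rewrite -natr1 => h; rewrite divr_ge0 ?addr_ge0 ?ler0n//= ler_pdivrMr// mul1r.
lra.
Qed.

(** Equal grid values make both functions fixed points of one operator, which contracts by
    [1 / 2]. *)
Lemma self_similar_unique (R : realType) (N : nat) (F G : R -> R) :
  (0 < N)%N -> unit_valued F -> unit_valued G ->
  self_similar N F -> self_similar N G -> halving N F ->
  (forall d, (d <= N)%N -> F (d%:R / N%:R) = G (d%:R / N%:R)) ->
  forall x, 0 <= x <= 1 -> F x = G x.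
Proof.
move=> N0 [_ _ uF] [_ _ uG] sF sG hF FG x x01; apply/eqP; rewrite -subr_eq0; apply/eqP.
move: x x01; apply: (@halving_eq0 _ _ _ (fun x => F x - G x) 1).
  move=> x x01; have /andP[? ?] := uF x x01; have /andP[? ?] := uG x x01.
  by rewrite ler_norml; apply/andP; split; lra.
move=> x /(digit_expansion _ _ _ N0)[d [y [dN y01 ->]]]; exists y => //.
rewrite (sF d y)// (sG d y)// -!FG// 1?ltnW//.
have /andP[D0 D1] := hF d dN.
set D := F (d.+1%:R / N%:R) - F (d%:R / N%:R) in D0 D1 *.
rewrite opprD addrACA subrr add0r -mulrBr normrM (ger0_norm D0) mulrC.
by rewrite ler_wpM2l.
Qed.

(* On the grid of mesh [1/(NM)] the function [F] is the [N]-rescaling of the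
   [M]-rescaling, and [G] the [M]-rescaling of the [N]-rescaling. Agreement
   there makes the two operations commute, so the defect of the [N]-relation
   for [G] reproduces itself, halved, under the [M]-relation. *)
Lemma self_similar_transfer (R : realType) (N M : nat) (F G : R -> R) :
  (0 < N)%N -> (0 < M)%N -> unit_valued F -> unit_valued G ->
  self_similar N F -> self_similar M G -> halving N F -> halving M G ->
  (forall k, (k <= N * M)%N -> F (k%:R / (N * M)%:R) = G (k%:R / (N * M)%:R)) ->
  self_similar N G.
Proof.
move=> N0 M0 [F0 F1 uF] [G0 G1 uG] sF sG hF hG FG.
have NR : (N%:R : R) != 0 by rewrite pnatr_eq0 -lt0n.
have MR : (M%:R : R) != 0 by rewrite pnatr_eq0 -lt0n.
have FGN d : (d <= N)%N -> F (d%:R / N%:R) = G (d%:R / N%:R).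
  move=> dN; rewrite (_ : d%:R / N%:R = (d * M)%:R / (N * M)%:R :> R).
    by apply: FG; rewrite leq_mul2r dN orbT.
  by rewrite !natrM; field; rewrite NR MR.
have FGM e : (e <= M)%N -> F (e%:R / M%:R) = G (e%:R / M%:R).
  move=> eM; rewrite (_ : e%:R / M%:R = (N * e)%:R / (N * M)%:R :> R).
    by apply: FG; rewrite leq_mul2l eM orbT.
  by rewrite !natrM; field; rewrite NR MR.
have grid (d A : nat) : (d <= A)%N -> (0 < A)%N -> 0 <= (d%:R / A%:R : R) <= 1.
  by move=> dA A0; rewrite divr_ge0//= ler_pdivrMr ?ltr0n// mul1r ler_nat.
pose E (t : nat * R) := G ((t.2 + t.1%:R) / N%:R) - (G (t.1%:R / N%:R)
   + (G (t.1.+1%:R / N%:R) - G (t.1%:R / N%:R)) * G t.2).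
suff EE : forall t, (t.1 < N)%N /\ 0 <= t.2 <= 1 -> E t = 0.
  move=> d x dN x01; apply/eqP; rewrite -subr_eq0; apply/eqP.
  exact: (EE (d, x)).
apply: (@halving_eq0 _ _ _ E 2) => -[d x]; rewrite /E /= => -[dN x01].
  have /andP[a0 a1] := uG _ (itv01_div _ _ _ _ dN x01).
  have /andP[b0 b1] := uG _ x01.
  have /andP[c0 c1] := hF d dN.
  have /andP[e0 e1] := uG _ (grid _ _ (ltnW dN) N0).
  rewrite !FGN// 1?ltnW// in c0 c1.
  set D := G (d.+1%:R / N%:R) - _ in c0 c1 *.
  have : 0 <= D * G x by rewrite mulr_ge0.
  have : D * G x <= 2^-1 * 1 by rewrite ler_pM.
  by move=> h1 h2; rewrite ler_norml; apply/andP; split; lra.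
have [e' [y [e'M y01 ->]]] := digit_expansion _ _ _ M0 x01.
(* The cell with [N]-digit [d] followed by [M]-digit [e'] is reread as [M]-digit [e] followed by
   [N]-digit [d']. *)
pose k := (d * M + e')%N.
have kNM : (k < N * M)%N.
  by apply: (@leq_trans (d.+1 * M)); rewrite ?leq_mul2r ?dN ?orbT// mulSn; lia.
pose e := (k %/ N)%N; pose d' := (k %% N)%N.
have eM : (e < M)%N by rewrite ltn_divLR// mulnC.
have d'N : (d' < N)%N by rewrite ltn_mod.
have kE : k = (e * N + d')%N by exact: divn_eq.
have kR : d%:R * M%:R + e'%:R = e%:R * N%:R + d'%:R :> R.
  by rewrite -!natrM -!natrD -kE.
have z01 := itv01_div _ _ _ _ d'N y01.
have commute (w : R) :
    ((w + e'%:R) / M%:R + d%:R) / N%:R = ((w + d'%:R) / N%:R + e%:R) / M%:R.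
  transitivity ((w + (d%:R * M%:R + e'%:R)) / (N%:R * M%:R)).
    by field; rewrite NR MR.
  by rewrite kR; field; rewrite NR MR.
(* both sides compute the common value of [F] and [G] at [j / (N * M)] *)
have step j c c' : (j <= N * M)%N -> (c <= M)%N -> (c' <= N)%N ->
    (j = d * M + c)%N -> (j = e * N + c')%N ->
    G (d%:R / N%:R) + (G (d.+1%:R / N%:R) - G (d%:R / N%:R)) * G (c%:R / M%:R) =
    G (e%:R / M%:R) + (G (e.+1%:R / M%:R) - G (e%:R / M%:R)) * G (c'%:R / N%:R).
  move=> jNM cM c'N j1 j2.
  rewrite -(FGN d) 1?ltnW// -(FGN d.+1)// -(FGM c)// -sF ?grid// -sG ?grid//.
  transitivity (F (j%:R / (N * M)%:R)).
    congr F; rewrite j1 natrD !natrM; field; by rewrite NR MR.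
  rewrite FG//; congr G; rewrite j2 natrD !natrM; field; by rewrite NR MR.
have s0 := step k e' d' (ltnW kNM) (ltnW e'M) (ltnW d'N) erefl kE.
have s1 := step k.+1 e'.+1 d'.+1 kNM e'M d'N (ltac:(by rewrite addnS))
  (ltac:(by rewrite addnS -kE)).
exists (d', y) => //=.
rewrite commute (sG e)// (sG e' y)//.
have /andP[D0 D1] := hG e eM.
set D := G (e.+1%:R / M%:R) - G (e%:R / M%:R) in D0 D1 s0 s1 *.
set A := G ((y + d'%:R) / N%:R).
set X := G (d%:R / N%:R) in s0 s1 *; set X' := G (d.+1%:R / N%:R) in s0 s1 *.
set Y := G (e%:R / M%:R) in s0 s1 *.
set Z := G (e'%:R / M%:R) in s0 *; set Z' := G (e'.+1%:R / M%:R) in s1 *.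
set W := G (d'%:R / N%:R) in s0 *; set W' := G (d'.+1%:R / N%:R) in s1 *.
(* Interpolating [s0] and [s1], the two ends of cell [k], with weights [1 - G y] and [G y] turns the
   defect at [(d, x)] into [D] times the one at [(d', y)]. *)
have -> : Y + D * A - (X + (X' - X) * (Z + (Z' - Z) * G y)) =
    D * (A - (W + (W' - W) * G y)).
  have -> : X + (X' - X) * (Z + (Z' - Z) * G y) =
    (X + (X' - X) * Z) * (1 - G y) + (X + (X' - X) * Z') * G y by ring.
  rewrite s0 s1; ring.
by rewrite normrM (ger0_norm D0) mulrC ler_wpM2l.
Qed.

(** * Self-similarity, left end and flat intervals of a Cantor distribution function *)

Lemma min_digit_lt (N : nat) (D : {set 'I_N}) (d0 : 'I_N) : cantor_data D ->
  d0 \in D -> (forall d, d \in D -> (d0 <= d)%N) -> (d0.+1 < N)%N.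
Proof.
move=> [_ [D2 _]] d0D d0min; rewrite ltnNge; apply/negP => h.
have : D \subset [set d0].
  apply/fintype.subsetP => d dD; rewrite inE; apply/eqP/val_inj => /=.
  have := d0min _ dD; have := ltn_ord d; lia.
by move/subset_leq_card; rewrite cards1 leqNgt D2.
Qed.

Section cantor_function_theory.
Context {R : realType} {N : nat} {D : {set 'I_N}} {F : R -> R}.
Hypotheses (dataD : cantor_data D) (cF : cantor_function N D F).

Let N1 : (1 < N)%N. Proof. by case: dataD => ? _; lia. Qed.
Let D1 : (1 < #|D|)%N. Proof. by case: dataD => _ []. Qed.
Let D0 : (0 : R) < #|D|%:R. Proof. by rewrite ltr0n ltnW. Qed.
Let NR : (0 : R) < N%:R. Proof. by rewrite ltr0n ltnW. Qed.

Lemma cantor_function_unit : unit_valued F.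
Proof.
split; [exact: cantor_function0 cF|exact: cantor_function1 cF|].
move=> x /andP[x0 x1].
rewrite -[X in X <= _ <= _](cantor_function0 _ _ _ cF).
rewrite -[X in _ <= _ <= X](cantor_function1 _ _ _ cF).
by rewrite !(cantor_function_le _ _ _ cF).
Qed.

Let gridE (d : 'I_N) : F (d%:R / N%:R) = (digits_below N D d)%:R / #|D|%:R.
Proof.
rewrite -[d%:R](add0r) (cantor_functionE _ _ _ cF) ?lexx ?ler01//.
by rewrite (cantor_function0 _ _ _ cF) mulr0 addr0.
Qed.

Let gridSE (d : 'I_N) : F (d.+1%:R / N%:R) =
  ((digits_below N D d)%:R + (d \in D)%:R) / #|D|%:R.
Proof.
rewrite -natr1 addrC (cantor_functionE _ _ _ cF) ?lexx ?ler01//.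
by rewrite (cantor_function1 _ _ _ cF) mulr1.
Qed.

Lemma cantor_function_self_similar : self_similar N F.
Proof.
move=> d x dN x01; have := cantor_functionE _ _ _ cF (Ordinal dN) x x01.
have /= -> := gridE (Ordinal dN); have /= -> := gridSE (Ordinal dN) => ->.
by field; rewrite gt_eqF.
Qed.

Lemma cantor_function_halving : halving N F.
Proof.
move=> d dN; have /= -> := gridE (Ordinal dN); have /= -> := gridSE (Ordinal dN).
rewrite -mulrBl addrAC subrr add0r divr_ge0 ?ler0n//=.
rewrite ler_pdivrMr//.
have : (2 : R) <= #|D|%:R by rewrite ler_nat.
have : ((Ordinal dN \in D)%:R : R) <= 1 by rewrite lern1 leq_b1.
lra.
Qed.

Variable d0 : 'I_N.
Hypotheses (d0D : d0 \in D) (d0min : forall d, d \in D -> (d0 <= d)%N).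

(* the fixed point of the first branch, i.e. the left end of the Cantor set *)
Let z : R := d0%:R / N.-1%:R.

Let d0N := min_digit_lt N D d0 dataD d0D d0min.

Let N1R : (0 : R) < N.-1%:R. Proof. by rewrite ltr0n; lia. Qed.

Lemma left_end_itv : 0 <= z < 1.
Proof.
rewrite /z divr_ge0//= ltr_pdivrMr// mul1r ltr_nat; move: d0N; lia.
Qed.

Let NzE : z * N%:R = z + d0%:R.
Proof.
have NE : (N%:R : R) = N.-1%:R + 1 by rewrite natr1 prednK// ltnW.
by rewrite NE /z; field; rewrite gt_eqF.
Qed.

Let below0 : digits_below N D d0 = 0%N.
Proof.
apply/eqP; rewrite cards_eq0; apply/eqP/setP => e; rewrite !inE.
by apply/negP => /andP[/d0min]; rewrite leqNgt => /negP.
Qed.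

(** The branch of [d0] fixes [z], and no digit lies below [d0], so each application just divides [F]
    by [#|D|]. *)
Lemma left_end_scaling (y : R) a : 0 <= y <= 1 ->
  F (z + (y - z) / N%:R ^+ a) = F y / #|D|%:R ^+ a.
Proof.
have /andP[z0 z1] := left_end_itv.
move=> /andP[y0 y1]; elim: a => [|a IH]; first by rewrite !expr0 !divr1 addrC subrK.
have Na : (0 : R) < N%:R ^+ a by rewrite exprn_gt0.
have Na1 : (1 : R) <= N%:R ^+ a by rewrite exprn_ege1// ler1n ltnW.
have -> : z + (y - z) / N%:R ^+ a.+1 = (z + (y - z) / N%:R ^+ a + d0%:R) / N%:R.
  have -> : d0%:R = z * N%:R - z by rewrite NzE; ring.
  by rewrite exprS; field; rewrite !gt_eqF.
rewrite (cantor_functionE _ _ _ cF).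
  by rewrite below0 d0D IH add0r mul1r exprS; field; rewrite expf_neq0 gt_eqF.
set t := (N%:R ^+ a)^-1.
have t0 : 0 <= t by rewrite invr_ge0 ltW.
have t1 : t <= 1 by rewrite invf_le1.
apply/andP; split; nra.
Qed.

Lemma left_end_eq0 : F z = 0.
Proof.
have /andP[z0 z1] := left_end_itv.
have := left_end_scaling z 1; rewrite z0 ltW// subrr mul0r addr0 => /(_ isT).
move/eqP; rewrite expr1 eq_sym mulrC -subr_eq0 -[X in _ - X]mul1r -mulrBl mulf_eq0.
have : (2 : R) <= #|D|%:R by rewrite ler_nat.
move=> D2; have : #|D|%:R^-1 <= (2^-1 : R) by rewrite lef_pV2 ?posrE.
by move=> h /orP[/eqP ?|/eqP//]; lra.
Qed.

(** Scaling from [y = 1] gives points arbitrarily close to [z] on the right where [F] is a power of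
    [1 / #|D|], hence positive. So [z] is the largest zero of [F]. *)
Lemma zero_le_left_end (x : R) : 0 <= x <= 1 -> F x = 0 -> x <= z.
Proof.
move=> /andP[x0 x1] Fx; rewrite leNgt; apply/negP => zx.
have /andP[z0 z1] := left_end_itv.
have [a ha] := expn_small R N (1 - z) (x - z) N1 (ltac:(by rewrite subr_gt0)).
have := left_end_scaling 1 a; rewrite ler01 lexx => /(_ isT) h.
have : F (z + (1 - z) / N%:R ^+ a) <= F x.
  apply: (cantor_function_le _ _ _ cF) => //; last lra.
  by rewrite addr_ge0// divr_ge0 ?exprn_ge0//; lra.
rewrite h Fx (cantor_function1 _ _ _ cF); apply/negP.
by rewrite -ltNge divr_gt0// exprn_gt0.
Qed.

(** If 0 is a digit, some other digit is missing and its whole cell is flat. Otherwise [F] vanishes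
    on [[0, z]], and the cell after [d0] opens with a scaled copy of that interval. Only [O(N)]
    pairs [(d0, k)] arise. *)
Lemma constant_interval : exists k : nat,
  let h := if d0 == 0%N :> nat then 1 else z in
  [/\ (k < N)%N, (d0 == 0%N :> nat) || (k == d0.+1), z < k%:R / N%:R,
      0 < h <= 1 & F ((k%:R + h) / N%:R) = F (k%:R / N%:R)].
Proof.
have /andP[z0 z1] := left_end_itv.
have [d00|d0n] := eqVneq (d0 : nat) 0%N.
  have [k kD] : exists k : 'I_N, k \notin D.
    apply/existsP; rewrite -negb_forall; apply/negP => /forallP all.
    have : D = [set: 'I_N] by apply/setP => x; rewrite !inE all.
    move=> DT; have := cardsT 'I_N; rewrite -DT card_ord.
    by case: dataD => _ [_]; lia.
  have k0 : (0 < k)%N.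
    rewrite lt0n; apply: contraNneq kD => k0.
    by rewrite (_ : k = d0)//; apply/val_inj; rewrite /= k0 d00.
  exists k; split => //; first by rewrite /z d00 mulr0n mul0r divr_gt0 // ltr0n.
    by rewrite ltr01 lexx.
  by rewrite natr1 gridSE gridE (negPf kD) addr0.
exists d0.+1; split => //.
- by rewrite eqxx orbT.
- rewrite /z ltr_pdivlMr// -/z NzE -natr1; lra.
- by rewrite ltW// andbT /z divr_gt0// ltr0n lt0n.
have z01 : 0 <= z <= 1 by rewrite z0 ltW.
have /= zE := cantor_functionE _ _ _ cF (Ordinal d0N) z z01.
by rewrite addrC zE left_end_eq0 mulr0 addr0 (gridE (Ordinal d0N)).
Qed.

End cantor_function_theory.

(** * Sets of uniqueness *)

(** The lists of points may leave [[0, 1]], where the functions are unconstrained. *)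
Definition agree_on {R : realType} (s : seq R) (F G : R -> R) : Prop :=
  forall x, x \in s -> 0 <= x <= 1 -> F x = G x.

Lemma self_similar_pair_unique (R : realType) (N M : nat) (F G : R -> R) :
  (0 < N)%N -> (0 < M)%N -> unit_valued F -> unit_valued G ->
  self_similar N F -> self_similar M G -> halving N F -> halving M G ->
  (forall k, (k <= N * M)%N -> F (k%:R / (N * M)%:R) = G (k%:R / (N * M)%:R)) ->
  forall x, 0 <= x <= 1 -> F x = G x.
Proof.
move=> N0 M0 uF uG sF sG hF hG FG.
apply: (self_similar_unique _ N) => //.
  exact: (self_similar_transfer _ N M F G).
move=> d dN; rewrite (_ : d%:R / N%:R = (d * M)%:R / (N * M)%:R :> R).
  by apply: FG; rewrite leq_mul2r dN orbT.
by rewrite !natrM; field; rewrite !pnatr_eq0 -!lt0n N0 M0.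
Qed.

(** From [N ^ r = M ^ s] and [N <= M] follows [s <= r], so [N ^ r] divides [M ^ r]. *)
Lemma commensurable_dvdn (R : realType) (N M : nat) :
  (1 < N)%N -> (N <= M)%N -> ~ incommensurable (ln (N%:R : R)) (ln M%:R) ->
  (N %| M)%N.
Proof.
move=> N1 NM nAB.
have [r [s [r0 s0 rs]]] : exists r s : nat,
    [/\ (0 < r)%N, (0 < s)%N & r%:R * ln (N%:R : R) = s%:R * ln M%:R].
  apply: contrapT => h; apply: nAB => r s r0 s0 rs; apply: h.
  by exists r, s.
have N0 : (0 : R) < N%:R by rewrite ltr0n; lia.
have M0 : (0 : R) < M%:R by rewrite ltr0n; lia.
have NrMs : (N ^ r = M ^ s)%N.
  apply/eqP; rewrite -(eqr_nat R) !natrX; apply/eqP/ln_inj.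
  - by rewrite posrE exprn_gt0.
  - by rewrite posrE exprn_gt0.
  - rewrite !lnXn// -(mulr_natl (ln N%:R)) -(mulr_natl (ln M%:R)); exact: rs.
have sr : (s <= r)%N.
  by rewrite -(@leq_exp2l M) ?(leq_trans N1)// -NrMs leq_exp2r.
rewrite -(dvdn_pexp2r _ _ r0) NrMs; exact: dvdn_exp2l.
Qed.

(* The interval of length [flat_width N d0 / N] starting at [k / N] is the one
   where [F] is constant. For [d0 = 0] it is the whole cell of a missing digit
   [k]; for [d0 > 0] the cell [k = d0 + 1] starts with such an interval whether
   or not its digit is present. *)
Definition flat_width {R : realType} (N d0 : nat) : R :=
  if d0 == 0%N then 1 else d0%:R / N.-1%:R.

Definition admissible (R : realType) (N M d0 k : nat) : Prop :=
  [/\ (1 < N)%N, (1 < M)%N & incommensurable (ln (N%:R : R)) (ln M%:R)] /\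
  [/\ 0 <= (d0%:R / N.-1%:R : R) < 1, d0%:R / N.-1%:R < k%:R / N%:R :> R,
      0 < (flat_width N d0 : R) <= 1 & (k < N)%N].

(** The digit sets are quantified after [s]: the points depend on four numbers only, which keeps
    their count polynomial. *)
Definition separating {R : realType} (N M d0 k : nat) (s : seq R) : Prop :=
  forall (D : {set 'I_N}) (E : {set 'I_M}) (F G : R -> R) (a : 'I_N) (b : 'I_M),
    cantor_data D -> cantor_data E ->
    cantor_function N D F -> cantor_function M E G ->
    a \in D -> (forall d, d \in D -> (a <= d)%N) ->
    b \in E -> (forall d, d \in E -> (b <= d)%N) ->
    a = d0 :> nat -> b%:R / M.-1%:R = d0%:R / N.-1%:R :> R ->
    F ((k%:R + flat_width N d0) / N%:R) = F (k%:R / N%:R) ->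
    ~ agree_on s F G.

Lemma separating_points (R : realType) (N M d0 k : nat) :
  exists s : seq R, (size s <= 3)%N /\
    (admissible R N M d0 k -> separating N M d0 k s).
Proof.
have [|nadm] := pselect (admissible R N M d0 k); last by exists [::].
rewrite /admissible /separating; set z := d0%:R / N.-1%:R; set h := flat_width N d0.
move=> [[N1 M1 NM] [/andP[z0 z1] zk /andP[h0 h1] kN]].
have NR : (0 : R) < N%:R by rewrite ltr0n ltnW.
have MR : (0 : R) < M%:R by rewrite ltr0n ltnW.
have w0 : 0 < 1 - z by rewrite subr_gt0.
set p := k%:R / N%:R in zk *; set q := (k%:R + h) / N%:R.
have pq : p < q by rewrite ltr_pM2r ?invr_gt0// ltrDl.
have q1 : q <= 1.
  rewrite ler_pdivrMr// mul1r; have : (k.+1%:R : R) <= N%:R by rewrite ler_nat.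
  rewrite -natr1; lra.
(* The flat interval from [p] to [q], in the coordinate that sends [z] to 0 and 1 to 1. *)
have [a [b [ab sep]]] := separating_exponents R N M ((p - z) / (1 - z))
  ((q - z) / (1 - z)) N1 M1
  (ltac:(by rewrite divr_gt0// subr_gt0))
  (ltac:(by rewrite ltr_pM2r ?invr_gt0// ltrD2r))
  (ltac:(by rewrite ler_pdivrMr// mul1r lerD2r)) NM.
exists [seq z + (1 - z) / M%:R ^+ b i | i : 'I_3]; split.
  by rewrite size_map -cardE card_ord.
move=> _ D E F G d e dataD dataE cF cG dD dmin eE emin dd0 ez Fpq FG.
have D1 : (1 < #|D|)%N by case: dataD => _ [].
have E1 : (1 < #|E|)%N by case: dataE => _ [].
have i01 : 0 <= (1 : R) <= 1 by rewrite ler01 lexx.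
apply: (sep #|D| #|E|) => //.
suff H i : #|D|%:R ^+ a i / #|E|%:R ^+ b i = F p by move=> i j; rewrite !H.
have /andP[lo hi] := ab i.
set t := N%:R ^+ a i / M%:R ^+ b i in lo hi.
rewrite ltr_pdivrMr// ltrBlDl in lo; rewrite ltr_pdivlMr// ltrBrDl in hi.
set y := z + t * (1 - z) in lo hi.
have y01 : 0 <= y <= 1 by apply/andP; split; lra.
have <- : F y = F p.
  apply/eqP; rewrite eq_le -{1}Fpq.
  rewrite !(cantor_function_le _ _ _ cF)//; lra.
have Na : (N%:R : R) ^+ a i != 0 by rewrite expf_neq0 ?gt_eqF.
have Mb : (M%:R : R) ^+ b i != 0 by rewrite expf_neq0 ?gt_eqF.
have Da : (#|D|%:R : R) ^+ a i != 0 by rewrite expf_neq0// pnatr_eq0 -lt0n ltnW.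
(* Contracting [y] by [N ^ a] towards [z] lands on the sample point, where [G] is known by
   contracting 1 by [M ^ b]. *)
have := left_end_scaling dataD cF d dD dmin y (a i) y01.
rewrite dd0 -/z.
have -> : z + (y - z) / N%:R ^+ a i = z + (1 - z) / M%:R ^+ b i.
  by rewrite /y /t; field; rewrite Na Mb.
rewrite FG; last 2 first.
- by apply/mapP; exists i; rewrite ?mem_enum.
- have Mb1 : (1 : R) <= M%:R ^+ b i by rewrite exprn_ege1// ler1n ltnW.
  have Mb0 : 0 < (M%:R ^+ b i)^-1 :> R by rewrite invr_gt0 exprn_gt0.
  have : (M%:R ^+ b i)^-1 <= 1 :> R by rewrite invf_le1// exprn_gt0.
  by move=> ?; apply/andP; split; nra.
have := left_end_scaling dataE cG e eE emin 1 (b i) i01.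
rewrite ez (cantor_function1 _ _ _ cG) mul1r => -> /(congr1 (fun u => u * #|D|%:R ^+ a i)).
by rewrite divfK// mulrC.
Qed.

Lemma min_digit (N : nat) (D : {set 'I_N}) : cantor_data D ->
  exists2 d0, d0 \in D & forall d, d \in D -> (d0 <= d)%N.
Proof.
move=> [_ [D2 _]].
have /card_gt0P[d dD] : (0 < #|D|)%N by lia.
by have [d0 d0D d0min] := arg_minnP (fun d : 'I_N => d : nat) dD; exists d0.
Qed.

Lemma agree_unique (R : realType) (f : nat * nat * nat * nat -> seq R)
    (N M : nat) (D : {set 'I_N}) (E : {set 'I_M}) (F G : R -> R) :
  (forall N M d0 k : nat, admissible R N M d0 k ->
    separating N M d0 k (f (N, M, d0, k))) ->
  cantor_data D -> cantor_data E ->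
  cantor_function N D F -> cantor_function M E G -> (N <= M)%N ->
  (forall k : nat, (k <= M ^ 2)%N ->
    F (k%:R / (M ^ 2)%:R) = G (k%:R / (M ^ 2)%:R)) ->
  (forall d : nat, (d < N.-1)%N -> F (d%:R / N.-1%:R) = G (d%:R / N.-1%:R)) ->
  (forall d : nat, (d < M.-1)%N -> F (d%:R / M.-1%:R) = G (d%:R / M.-1%:R)) ->
  (forall k : nat, (k < N)%N -> agree_on (f (N, M, 0%N, k)) F G) ->
  (forall d : nat, (d.+1 < N)%N -> agree_on (f (N, M, d, d.+1)) F G) ->
  forall x, 0 <= x <= 1 -> F x = G x.
Proof.
move=> fP dataD dataE cF cG NM grid zN zM f0 fd.
have N1 : (1 < N)%N by case: dataD; lia.
have M1 : (1 < M)%N by exact: leq_trans NM.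
have [AB|nAB] := pselect (incommensurable (ln (N%:R : R)) (ln M%:R)).
  have [a aD amin] := min_digit _ _ dataD.
  have [b bE bmin] := min_digit _ _ dataE.
  have aN := min_digit_lt N D a dataD aD amin.
  have bM := min_digit_lt M E b dataE bE bmin.
  have za := @left_end_itv R _ _ dataD a aD amin.
  have zb := @left_end_itv R _ _ dataE b bE bmin.
  (* Each left end is a zero of the other function too, and each is the largest zero of its own. *)
  have zE : b%:R / M.-1%:R = a%:R / N.-1%:R :> R.
    apply/eqP; rewrite eq_le; apply/andP; split.
      apply: (zero_le_left_end dataD cF a aD amin).
        by case/andP: zb => -> /ltW.
      by rewrite zM ?ltn_predRL//; exact: left_end_eq0 dataE cG b bE bmin.
    apply: (zero_le_left_end dataE cG b bE bmin).
      by case/andP: za => -> /ltW.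
    by rewrite -zN ?ltn_predRL//; exact: left_end_eq0 dataD cF a aD amin.
  have [k [kN kor zk h01 Fk]] := constant_interval dataD cF a aD amin.
  have adm : admissible R N M a k by [].
  exfalso; apply: (fP N M a k adm D E F G a b) => //.
  case/orP: kor => [/eqP -> | /eqP ->]; [exact: f0|exact: fd].
have NdM := commensurable_dvdn _ _ _ N1 NM nAB.
have N0 : (0 < N)%N by lia.
have M0 : (0 < M)%N by lia.
apply: (self_similar_pair_unique _ N M) => //.
- exact: cantor_function_unit cF.
- exact: cantor_function_unit cG.
- exact: cantor_function_self_similar dataD cF.
- exact: cantor_function_self_similar dataE cG.
- exact: cantor_function_halving dataD cF.
- exact: cantor_function_halving dataE cG.
move=> k kNM.
rewrite (_ : k%:R / (N * M)%:R = (k * (M %/ N))%:R / (M ^ 2)%:R :> R).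
  apply: grid; rewrite (_ : M ^ 2 = N * M * (M %/ N))%N ?leq_mul2r ?kNM ?orbT//.
  by rewrite -mulnA (mulnC M) mulnA (mulnC N) divnK// mulnn.
rewrite -{3}(divnK NdM) expnS expn1 !natrM.
have : (M %/ N > 0)%N by rewrite divn_gt0// dvdn_leq.
rewrite lt0n -(pnatr_eq0 R) => q0.
have NR : (N%:R : R) != 0 by rewrite pnatr_eq0 -lt0n.
have MR : (M%:R : R) != 0 by rewrite pnatr_eq0 -lt0n.
have ME : (M%:R : R) = (M %/ N)%:R * N%:R by rewrite -natrM divnK.
by rewrite ME; field; rewrite q0 NR.
Qed.

Theorem theorem2p5 (R : realType) :
  exists (C K0 : nat), forall K : nat, (3 <= K)%N ->
    exists (M : nat) (x : 'I_M -> R),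
      (0 < M)%N /\ ((K0 <= K)%N -> (M <= C * K ^ 3)%N) /\
      (forall i, 0 < x i < 1) /\
      (forall F G : R -> R, in_GK K F -> in_GK K G ->
         (forall i, F (x i) = G (x i)) ->
         forall y : R, 0 <= y <= 1 -> F y = G y).
Proof.
(* With [L = K + 1 <= 2 * K] there are at most [1 + L ^ 3 + L ^ 2 + 6 * L ^ 3 <= 9 * L ^ 3] points,
   and [72 = 9 * 2 ^ 3]. *)
exists 72%N, 0%N => K K3.
have [f fP] := choice (fun t : nat * nat * nat * nat =>
  separating_points R t.1.1.1 t.1.1.2 t.1.2 t.2).
pose I := iota 0 K.+1.
(* One grid per scale; a separate grid for each pair of scales would cost order [K ^ 4] points. *)
pose T1 := [seq k%:R / (m ^ 2)%:R : R | m <- I, k <- iota 0 (K.+1 ^ 2)].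
pose T2 := [seq d%:R / n.-1%:R : R | n <- I, d <- I].
pose g (p : nat * nat) := flatten
  [seq f (p.1, p.2, 0%N, k) ++ f (p.1, p.2, k, k.+1) | k <- I].
pose T3 := flatten [seq g (n, m) | n <- I, m <- I].
(* The point [1 / 2] ensures that the filtered list is not empty. *)
pose s := 2^-1 :: T1 ++ T2 ++ T3.
have T1s : {subset T1 <= s} by move=> x xT; rewrite in_cons mem_cat xT orbT.
have T2s : {subset T2 <= s}.
  by move=> x xT; rewrite in_cons mem_cat (mem_cat x T2) xT !orbT.
have T3s : {subset T3 <= s}.
  by move=> x xT; rewrite in_cons mem_cat (mem_cat x T2) xT !orbT.
pose s' := [seq x <- s | 0 < x < 1].
exists (size s'), (fun i => nth 0 s' i).
have half : 0 < (2^-1 : R) < 1 by rewrite invr_gt0 ltr0n invf_lt1 ?ltr1n.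
split; first by rewrite /s' /s /= half.
split.
  move=> _; apply: (@leq_trans (size s)); first by rewrite size_filter count_size.
  have T1E : size T1 = (K.+1 * K.+1 ^ 2)%N by rewrite size_allpairs !size_iota.
  have T2E : size T2 = (K.+1 * K.+1)%N by rewrite size_allpairs !size_iota.
  have flat (A : Type) (B : eqType) (h : B -> seq A) c (r : seq B) :
      (forall y, size (h y) <= c)%N -> (size (flatten (map h r)) <= size r * c)%N.
    by move=> hc; elim: r => //= y r IH; rewrite size_cat mulSn leq_add.
  have g6 p : (size (g p) <= K.+1 * 6)%N.
    apply: leq_trans (flat _ _ _ 6 _ _) _; last by rewrite size_iota.
    by move=> k; rewrite size_cat (leq_add (proj1 (fP _)) (proj1 (fP _))).
  have T36 : (size T3 <= K.+1 * K.+1 * (K.+1 * 6))%N.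
    rewrite /T3 -(map_allpairs g pair).
    apply: leq_trans (flat _ _ _ _ _ g6) _.
    by rewrite size_allpairs !size_iota.
  have K2 : (K.+1 <= 2 * K)%N by lia.
  have : (K.+1 ^ 3 <= (2 * K) ^ 3)%N by rewrite leq_exp2r.
  have -> : size s = (size T1 + (size T2 + size T3)).+1 by rewrite -!size_cat.
  rewrite T1E T2E expnMn.
  have K1 : (1 <= K.+1)%N by [].
  clear -T36 K1; rewrite !expnS expn0; nia.
split.
  by move=> i; have := mem_nth 0 (ltn_ord i); rewrite mem_filter => /andP[].
move=> F G [N [D [NK [dataD [mu [imu Fmu]]]]]] [M [E [MK [dataE [nu [inu Gnu]]]]]].
have cF := invariant_cantor_function dataD mu imu F Fmu.
have cG := invariant_cantor_function dataE nu inu G Gnu.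
(* The points 0 and 1 removed by the filter cost nothing, as the values there are fixed. *)
move=> FGs; have {}FGs : agree_on s F G.
  move=> x xs /andP[x0 x1].
  have [->|xn0] := eqVneq x 0.
    by rewrite (cantor_function0 _ _ _ cF) (cantor_function0 _ _ _ cG).
  have [->|xn1] := eqVneq x 1.
    by rewrite (cantor_function1 _ _ _ cF) (cantor_function1 _ _ _ cG).
  have xs' : x \in s'.
    by rewrite mem_filter xs andbT !lt_neqAle x0 x1 eq_sym xn0 xn1.
  have := FGs (Ordinal (ltac:(by rewrite index_mem) : (index x s' < size s')%N)).
  by rewrite /= nth_index.
have ratio (d A : nat) : (d <= A)%N -> 0 <= (d%:R / A%:R : R) <= 1.
  move=> dA; rewrite divr_ge0//=.
  (* A zero denominator yields the ratio 0. *)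
  have [->|A0] := posnP A; first by rewrite invr0 mulr0 ler01.
  by rewrite ler_pdivrMr ?ltr0n// mul1r ler_nat.
have grid m k : (m <= K)%N -> (k <= m ^ 2)%N ->
    F (k%:R / (m ^ 2)%:R) = G (k%:R / (m ^ 2)%:R).
  move=> mK km; apply: FGs; last exact: ratio.
  apply/T1s/(allpairs_f (fun m k : nat => k%:R / (m ^ 2)%:R : R));
    rewrite mem_iota leq0n add0n; first by rewrite ltnS.
  by apply: leq_ltn_trans km _; rewrite ltn_exp2r.
have zs m d : (m <= K)%N -> (d < m.-1)%N -> F (d%:R / m.-1%:R) = G (d%:R / m.-1%:R).
  move=> mK dm; apply: FGs; last exact/ratio/ltnW.
  apply/T2s/(allpairs_f (fun n d : nat => d%:R / n.-1%:R : R));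
    rewrite mem_iota add0n ltnS//.
  exact: leq_trans (ltnW dm) (leq_trans (leq_pred m) mK).
have fs n m k x : (n <= K)%N -> (m <= K)%N -> (k <= K)%N ->
    x \in f (n, m, 0%N, k) ++ f (n, m, k, k.+1) -> 0 <= x <= 1 -> F x = G x.
  move=> nK mK kK xf x01; apply: FGs => //.
  apply/T3s/flattenP; exists (g (n, m)).
    by apply: (allpairs_f (fun n m : nat => g (n, m))); rewrite mem_iota.
  by apply/flattenP; exists (f (n, m, 0%N, k) ++ f (n, m, k, k.+1)) => //;
    apply/mapP; exists k; rewrite ?mem_iota.
have fP' N M d0 k := proj2 (fP (N, M, d0, k)).
have [NM|/ltnW MN] := leqP N M.
  apply: (agree_unique R f N M D E) => //.
  - by move=> k; exact: grid.
  - by move=> d; exact: zs.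
  - by move=> d; exact: zs.
  - move=> k kN x xf; apply: (fs N M k) => //; first by lia.
    by rewrite mem_cat xf.
  - move=> k kN x xf; apply: (fs N M k) => //; first by lia.
    by rewrite mem_cat xf orbT.
move=> y y01; apply/esym; move: y y01.
apply: (agree_unique R f M N E D) => //.
- by move=> k kN; apply/esym; exact: grid.
- by move=> d dN; apply/esym; exact: zs.
- by move=> d dN; apply/esym; exact: zs.
- move=> k kN x xf x01; apply/esym; apply: (fs M N k) => //; first by lia.
  by rewrite mem_cat xf.
- move=> k kN x xf x01; apply/esym; apply: (fs M N k) => //; first by lia.
  by rewrite mem_cat xf orbT.
Qed.
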